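(* Consider the feedback interconnection $$\dot x_1=f_1(x_1,x_2),\qquad\dot x_2=f_2(x_1,x_2).$$ Suppose System 1 is partially contracting with respect to $x_1$, i.e. there exists a differential change of coordinates $\Theta_1(x_1)$ such that $F_1:=\Theta_1\frac{\partial f_1}{\partial x_1}\Theta_1^{-1}+\dot\Theta_1\Theta_1^{-1}$ satisfies $F_1+F_1'<0$. Suppose also that System 2 is partially transverse contracting with respect to $x_2$, in the sense that there exists a differential change of coordinates $\Theta_2(x_2)$ such that $F_2:=\Theta_2\frac{\partial f_2}{\partial x_2}\Theta_2^{-1}+\dot\Theta_2\Theta_2^{-1}$ satisfies $F_2+F_2'\le0$, and $\delta_2'(F_2+F_2')\delta_2<0$ whenever $\delta_2\neq0$ satisfies $\delta_2'\Theta_2f_2=0$. Define $$G_{12}:=\Theta_1\frac{\partial f_1}{\partial x_2}\Theta_2^{-1},\qquad G_{21}:=\Theta_2\frac{\partial f_2}{\partial x_1}\Theta_1^{-1},$$ and suppose $G_{12}=-kG_{21}'$ for some constant $k>0$. Then the interconnection is transverse contracting.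
   Context: A prime denotes transpose; matrix inequalities are in the sense of (semi)definiteness. $f_1,f_2$ are smooth, and all hypotheses are understood to hold at every $(x_1,x_2)$ in the region $K$ of state space under consideration. A differential change of coordinates $\Theta_i(x_i)$ is a smooth, everywhere nonsingular square matrix function, and $\dot\Theta_i$ is its derivative along solutions, $\dot\Theta_i=\sum_j\frac{\partial\Theta_i}{\partial(x_i)_j}(f_i(x_1,x_2))_j$. A system $\dot x=f(x)$ is transverse contracting (on $K$) if there exists a differential change of coordinates $\delta_z=\Theta(x)\delta_x$ (smooth, nonsingular) such that the generalized Jacobian $F:=\Theta\frac{\partial f}{\partial x}\Theta^{-1}+\dot\Theta\Theta^{-1}$ satisfies $\delta_z'(F+F')\delta_z<0$ for all $\delta_z\neq0$ satisfying $\delta_z'\Theta(x)f(x)=0$. For the interconnection, $x=(x_1,x_2)$ and $f=(f_1,f_2)$. *)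

(* Defs.v *)
From HB Require Import structures.
From mathcomp Require Import all_boot all_order all_algebra.
From mathcomp Require Import all_classical all_reals all_analysis.
Import Order.TTheory GRing.Theory Num.Theory numFieldNormedType.Exports.

Set Implicit Arguments.
Unset Strict Implicit.
Unset Printing Implicit Defensive.

Local Open Scope classical_set_scope.
Local Open Scope ring_scope.

(* States are column vectors, so the Jacobian of g has entries d g_i / d x_j.
   The library's 'J is for row vectors and is the transpose of this one. *)
Definition partial {R : realType} {n : nat} (j : 'I_n) (g : 'cV[R]_n -> R)
    (x : 'cV[R]_n) : R :=
  'D_(delta_mx j 0) g x.

Definition partial_mx {R : realType} {n p q : nat} (j : 'I_n)
    (M : 'cV[R]_n -> 'M[R]_(p, q)) (x : 'cV[R]_n) : 'M[R]_(p, q) :=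
  \matrix_(a, b) partial j (fun y => M y a b) x.

Definition jac {R : realType} {n p : nat} (g : 'cV[R]_n -> 'cV[R]_p)
    (x : 'cV[R]_n) : 'M[R]_(p, n) :=
  \matrix_(i, j) partial j (fun y => g y i 0) x.

Definition iter_partial {R : realType} {n : nat} (s : seq 'I_n)
    (g : 'cV[R]_n -> R) : 'cV[R]_n -> R :=
  foldr partial g s.

(* C^oo on X, entry by entry: all partial derivatives of all orders exist and
   are continuous at the points of X. Meant for an open set X. *)
Definition smooth_on {R : realType} {n p q : nat} (X : set 'cV[R]_n)
    (M : 'cV[R]_n -> 'M[R]_(p, q)) : Prop :=
  forall (a : 'I_p) (b : 'I_q) (s : seq 'I_n) (x : 'cV[R]_n), X x ->
    let h := iter_partial s (fun y => M y a b) in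
    {for x, continuous h} /\ forall j : 'I_n, derivable h x (delta_mx j 0).

Definition diff_change_coord {R : realType} {n : nat} (X : set 'cV[R]_n)
    (Theta : 'cV[R]_n -> 'M[R]_n) : Prop :=
  smooth_on X Theta /\ forall x, X x -> Theta x \in unitmx.

(* Derivative of Theta along a motion with velocity v at x. *)
Definition dot {R : realType} {n : nat} (Theta : 'cV[R]_n -> 'M[R]_n)
    (v x : 'cV[R]_n) : 'M[R]_n :=
  \sum_(j < n) v j 0 *: partial_mx j Theta x.

(* For a subsystem, g is the vector field with the state of the other
   subsystem frozen; dot only involves the value of g at x, so this is the
   derivative of Theta along the solutions of the full system. *)
Definition gen_jacobian {R : realType} {n : nat} (Theta : 'cV[R]_n -> 'M[R]_n)
    (g : 'cV[R]_n -> 'cV[R]_n) (x : 'cV[R]_n) : 'M[R]_n :=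
  Theta x *m jac g x *m invmx (Theta x)
  + dot Theta (g x) x *m invmx (Theta x).

Definition qform {R : realType} {n : nat} (M : 'M[R]_n) (v : 'cV[R]_n) : R :=
  (v^T *m M *m v) 0 0.

Definition neg_def {R : realType} {n : nat} (M : 'M[R]_n) : Prop :=
  forall v : 'cV[R]_n, v != 0 -> qform M v < 0.

Definition neg_semidef {R : realType} {n : nat} (M : 'M[R]_n) : Prop :=
  forall v : 'cV[R]_n, qform M v <= 0.

(* X is the state space, K the region on which the inequality is required. *)
Definition transverse_contracting {R : realType} {n : nat}
    (X K : set 'cV[R]_n) (f : 'cV[R]_n -> 'cV[R]_n) : Prop :=
  exists Theta : 'cV[R]_n -> 'M[R]_n,
    diff_change_coord X Theta /\
    forall x, K x ->
      let F := gen_jacobian Theta f x in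
      forall dz : 'cV[R]_n, dz != 0 -> dz^T *m Theta x *m f x = 0 ->
        qform (F + F^T) dz < 0.

Definition of_pair {R : realType} {n1 n2 p : nat}
    (g : 'cV[R]_n1 -> 'cV[R]_n2 -> 'cV[R]_p) (x : 'cV[R]_(n1 + n2)) :
    'cV[R]_p :=
  g (usubmx x) (dsubmx x).

Definition interconnection {R : realType} {n1 n2 : nat}
    (f1 : 'cV[R]_n1 -> 'cV[R]_n2 -> 'cV[R]_n1)
    (f2 : 'cV[R]_n1 -> 'cV[R]_n2 -> 'cV[R]_n2) (x : 'cV[R]_(n1 + n2)) :
    'cV[R]_(n1 + n2) :=
  col_mx (of_pair f1 x) (of_pair f2 x).

(* Main.v *)
Require Import Defs.
From HB Require Import structures.
From mathcomp Require Import all_boot all_order all_algebra.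
From mathcomp Require Import all_classical all_reals all_analysis.
Import Order.TTheory GRing.Theory Num.Theory numFieldNormedType.Exports.
Set Implicit Arguments.
Unset Strict Implicit.
Unset Printing Implicit Defensive.

Local Open Scope classical_set_scope.
Local Open Scope ring_scope.

(** The metric of the interconnection is the block diagonal change of
    coordinates [Theta x = block_mx (Theta1 x1) 0 0 (c *: Theta2 x2)] with
    [c = Num.sqrt k]. Its generalized Jacobian has the blocks
    [[
      F1           c^-1 *: G12
      c *: G21     F2
    ]]
    ([gen_jacobian_block_diag]): a constant factor cancels in the diagonal
    blocks and only rescales the coupling. As [G12 = - k *: G21^T] and
    [c ^+ 2 = k], the off-diagonal blocks are opposite transposes of each
    other, so they cancel in the symmetric part and the quadratic form of
    [F + F^T] at [(d1, d2)] is [q1 d1 + q2 d2], where [q1] is negative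
    definite and [q2] is negative semidefinite ([qform_skew_coupling]).
    If [d1 != 0] the sum is negative because of [q1]. If [d1 = 0] then
    [d2 != 0], and orthogonality of [(0, d2)] to [Theta f] reduces to
    orthogonality of [d2] to [Theta2 f2], where [q2] is negative.

    On the analytic side, the subsystems live on complementary
    coordinates. The restriction of a function to a line parallel to an axis
    determines its partial derivative on that axis ([derive_eq_line]), so
    that partial derivatives of [g \o rowsub s] are those of [g] or zero.
    These identities equate the difference quotients themselves, so they hold
    at every point and are equalities of functions; this is why they can be
    iterated along a sequence of derivations to transport smoothness
    ([smooth_on_rowsub]). *)

(** * Partial derivatives on complementary coordinates *)

Lemma derive_eq_line (R : realType) (V V' W : normedModType R)
    (g : V -> W) (g' : V' -> W) (x v : V) (x' v' : V') :
    (forall t : R, g (t *: v + x) = g' (t *: v' + x')) ->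
  'D_v g x = 'D_v' g' x' /\ (derivable g' x' v' -> derivable g x v).
Proof.
move=> gg'.
have gx : g x = g' x' by have := gg' 0; rewrite !scale0r !add0r.
have E : (fun h => h^-1 *: ((g \o shift x) (h *: v) - g x)) =
    (fun h => h^-1 *: ((g' \o shift x') (h *: v') - g' x')).
  by apply/funext => h /=; rewrite gg' gx.
by rewrite /derive /derivable E.
Qed.

Lemma partial_eq_line (R : realType) (n m : nat) (i : 'I_n) (j : 'I_m)
    (g : 'cV[R]_n -> R) (g' : 'cV[R]_m -> R) x x' :
    (forall t : R, g (t *: delta_mx i 0 + x) = g' (t *: delta_mx j 0 + x')) ->
  partial i g x = partial j g' x'.
Proof. by move=> /derive_eq_line[]. Qed.

Lemma partial_cst (R : realType) (n : nat) (i : 'I_n) (c : R) :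
  partial i (cst c : 'cV[R]_n -> R) = cst 0.
Proof. by apply/funext => x; exact: derive_cst. Qed.

(** This is an equality of functions, so that it can be iterated: where [g]
    has no partial derivative, both sides are [0] because the default value
    of a divergent limit is [0]. *)
Lemma partialZ (R : realType) (n : nat) (i : 'I_n) (c : R)
    (g : 'cV[R]_n -> R) :
  partial i (fun y => c * g y) = (fun y => c * partial i g y).
Proof.
have [->|c0] := eqVneq c 0.
  under eq_fun do rewrite mul0r.
  by rewrite (partial_cst i 0); apply/funext => x /=; rewrite mul0r.
apply/funext => x; rewrite /partial.
have [gd|gnd] := pselect (derivable g x (delta_mx i 0)).
  exact: (deriveZ c gd).
have cgnd : ~ derivable (fun y => c * g y) x (delta_mx i 0).
  move=> /(@derivableZ _ _ _ _ c^-1) cgd; apply: gnd.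
  rewrite (_ : g = c^-1 \*: (fun y => c * g y)) //.
  by apply/funext => y; rewrite /= [_ *: _]mulrA mulVf ?mul1r.
by rewrite /derive (dvgP gnd) (dvgP cgnd) [point](_ : _ = 0) ?mulr0.
Qed.

Section coordinate_projection.
Context (R : realType) (n m : nat) (s : 'I_m -> 'I_n) (s_inj : injective s).
Implicit Types (g : 'cV[R]_m -> R) (x y : 'cV[R]_n).

Lemma rowsub_delta_codom i :
  rowsub s (delta_mx (s i) 0 : 'cV[R]_n) = delta_mx i 0.
Proof. by apply/matrixP => a b; rewrite !mxE (inj_eq s_inj). Qed.

Lemma rowsub_delta_notin j : j \notin codom s ->
  rowsub s (delta_mx j 0 : 'cV[R]_n) = 0.
Proof.
move=> js; apply/matrixP => a b; rewrite !mxE.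
by case: eqP => //= saj; rewrite -saj codom_f in js.
Qed.

Lemma rowsub_line (t : R) x y :
  rowsub s (t *: x + y) = t *: rowsub s x + rowsub s y.
Proof. by apply/matrixP => a b; rewrite !mxE. Qed.

Lemma partial_rowsub_codom g i :
  partial (s i) (g \o rowsub s) = partial i g \o rowsub s.
Proof.
apply/funext => x; apply: partial_eq_line => t /=.
by rewrite rowsub_line rowsub_delta_codom.
Qed.

Lemma partial_rowsub_notin g j : j \notin codom s ->
  partial j (g \o rowsub s) = cst 0.
Proof.
move=> js; apply/funext => x.
rewrite -[RHS](derive_cst (g (rowsub s x)) x (delta_mx j 0)).
apply: partial_eq_line => t /=.
by rewrite rowsub_line rowsub_delta_notin // scaler0 add0r.
Qed.

Lemma iter_partial_cst0 (t : seq 'I_n) :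
  iter_partial t (cst 0 : 'cV[R]_n -> R) = cst 0.
Proof. by elim: t => //= j t ->; rewrite partial_cst. Qed.

(** The derivations in [t] along the coordinates kept by [s] survive as
    derivations of [g]; a single one along a dropped coordinate kills the
    whole iterate. *)
Lemma iter_partial_rowsub g (t : seq 'I_n) :
  (exists t', iter_partial t (g \o rowsub s) = iter_partial t' g \o rowsub s)
  \/ iter_partial t (g \o rowsub s) = cst 0.
Proof.
elim: t => [|j t [[t' IH]|IH]] /=; first by left; exists [::].
  rewrite IH; have [/codomP[i ->]|js] := boolP (j \in codom s).
    by left; exists (i :: t'); rewrite partial_rowsub_codom.
  by right; rewrite partial_rowsub_notin.
by right; rewrite IH partial_cst.
Qed.

Lemma continuous_rowsub : continuous (rowsub s : 'cV[R]_n -> 'cV[R]_m).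
Proof.
move=> x A [P Px PA]; rewrite /nbhs /=.
have : \forall y \near x, forall i, P i 0 ((y : 'cV[R]_n) (s i) 0).
  apply: (@filter_forall _ _ (fun i (y : 'cV[R]_n) => P i 0 (y (s i) 0))
    (nbhs x) (nbhs_filter x)) => i.
  apply: (@coord_continuous R n 1 (s i) 0 x).
  by have := Px i 0; rewrite !mxE.
by apply: filterS => y Py; apply: PA => i j; rewrite mxE (ord1 j).
Qed.

Lemma derivable_rowsub g x j :
  (forall i, derivable g (rowsub s x) (delta_mx i 0)) ->
  derivable (g \o rowsub s) x (delta_mx j 0).
Proof.
move=> gd; have [/codomP[i ->]|js] := boolP (j \in codom s).
  have [t|_] := derive_eq_line (g := g \o rowsub s) (g' := g)
    (x := x) (v := delta_mx (s i) 0) (x' := rowsub s x) (v' := delta_mx i 0).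
    by rewrite /= rowsub_line rowsub_delta_codom.
  by apply; exact: gd.
have [t|_] := derive_eq_line (g := g \o rowsub s)
  (g' := cst (g (rowsub s x))) (x := x) (v := delta_mx j 0)
  (x' := x) (v' := delta_mx j 0).
  by rewrite /= rowsub_line rowsub_delta_notin // scaler0 add0r.
by apply; exact: derivable_cst.
Qed.

Lemma smooth_on_rowsub p q (X : set 'cV[R]_n)
    (M : 'cV[R]_m -> 'M[R]_(p, q)) :
  smooth_on (rowsub s @` X) M -> smooth_on X (M \o rowsub s).
Proof.
move=> smM a b t x Xx /=.
have [[t' ->]|->] := iter_partial_rowsub (fun z => M z a b) t; last first.
  by split=> [|j]; [exact: cst_continuous | exact: derivable_cst].
have [ct dv] := smM a b t' _ (imageP _ Xx).
split=> [|j]; first by apply: continuous_comp ct; exact: continuous_rowsub.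
exact: derivable_rowsub.
Qed.

(** The chain rule for [M \o rowsub s] along [v]. With [p = q = m] the right
    side is [dot M (rowsub s v) (rowsub s x)]; the left side is not an
    instance of [dot], whose matrices have the size of the state. *)
Lemma sum_partial_mx_rowsub p q (M : 'cV[R]_m -> 'M[R]_(p, q))
    (v : 'cV[R]_n) x :
  \sum_j v j 0 *: partial_mx j (M \o rowsub s) x =
  \sum_i rowsub s v i 0 *: partial_mx i M (rowsub s x).
Proof.
rewrite (bigID [in s @: (finset.setT : {set _})]) /= [X in _ + X]big1 ?addr0 => [|j js].
  rewrite big_imset => [/=|? ? _ _ /s_inj //].
  apply: eq_big => i; first by rewrite inE.
  move=> _; rewrite mxE; congr (_ *: _); apply/matrixP => a b; rewrite !mxE.
  by rewrite [LHS](congr1 (@^~ x) (partial_rowsub_codom (fun z => M z a b) i)).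
have {}js : j \notin codom s.
  by apply: contra js => /codomP[i ->]; exact: imset_f.
apply/matrixP => a b; rewrite !mxE.
have /(congr1 (@^~ x)) /= -> := partial_rowsub_notin (fun z => M z a b) js.
by rewrite mulr0.
Qed.

End coordinate_projection.

(** * Smoothness and derivatives of block diagonal metrics *)

Lemma smooth_onZ (R : realType) (n p q : nat) (X : set 'cV[R]_n) (c : R)
    (M : 'cV[R]_n -> 'M[R]_(p, q)) :
  smooth_on X M -> smooth_on X (fun y => c *: M y).
Proof.
move=> smM a b t x Xx /=.
have -> : iter_partial t (fun y => (c *: M y) a b) =
    (fun y => c * iter_partial t (fun y => M y a b) y).
  elim: t => [|j t /= ->]; first by apply/funext => y /=; rewrite mxE.
  exact: partialZ.
have [ct dv] := smM a b t x Xx; split=> [|j]; last exact: derivableZ.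
by apply: cvgM ct; exact: cvg_cst.
Qed.

Lemma smooth_on_block_diag (R : realType) (n p q : nat) (X : set 'cV[R]_n)
    (A : 'cV[R]_n -> 'M[R]_p) (B : 'cV[R]_n -> 'M[R]_q) :
  smooth_on X A -> smooth_on X B ->
  smooth_on X (fun y => block_mx (A y) 0 0 (B y)).
Proof.
move=> smA smB a b t x Xx.
have sm0 : let h := iter_partial t (cst 0 : 'cV[R]_n -> R) in
    {for x, continuous h} /\ forall j, derivable h x (delta_mx j 0).
  rewrite /= iter_partial_cst0.
  by split=> [|j]; [exact: cst_continuous | exact: derivable_cst].
case: (split_ordP a) => i ->; case: (split_ordP b) => j ->.
- rewrite (_ : (fun y => _) = (fun y => A y i j)); first exact: smA.
  by apply/funext => y; rewrite block_mxEul.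
- rewrite (_ : (fun y => _) = cst 0) //.
  by apply/funext => y; rewrite block_mxEur mxE.
- rewrite (_ : (fun y => _) = cst 0) //.
  by apply/funext => y; rewrite block_mxEdl mxE.
- rewrite (_ : (fun y => _) = (fun y => B y i j)); first exact: smB.
  by apply/funext => y; rewrite block_mxEdr.
Qed.

Lemma partial_mx_block_diag (R : realType) (n p q : nat) (k : 'I_n)
    (A : 'cV[R]_n -> 'M[R]_p) (B : 'cV[R]_n -> 'M[R]_q) (x : 'cV[R]_n) :
  partial_mx k (fun y => block_mx (A y) 0 0 (B y)) x =
  block_mx (partial_mx k A x) 0 0 (partial_mx k B x).
Proof.
apply/matrixP => a b; rewrite mxE.
case: (split_ordP a) => i ->; case: (split_ordP b) => j ->.
- rewrite block_mxEul mxE; congr (partial _ _ _).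
  by apply/funext => y; rewrite block_mxEul.
- rewrite block_mxEur mxE (_ : (fun y => _) = cst 0) ?partial_cst //.
  by apply/funext => y; rewrite block_mxEur mxE.
- rewrite block_mxEdl mxE (_ : (fun y => _) = cst 0) ?partial_cst //.
  by apply/funext => y; rewrite block_mxEdl mxE.
- rewrite block_mxEdr mxE; congr (partial _ _ _).
  by apply/funext => y; rewrite block_mxEdr.
Qed.

Lemma partial_mxZ (R : realType) (n p q : nat) (k : 'I_n) (c : R)
    (M : 'cV[R]_n -> 'M[R]_(p, q)) (x : 'cV[R]_n) :
  partial_mx k (fun y => c *: M y) x = c *: partial_mx k M x.
Proof.
apply/matrixP => a b; rewrite !mxE.
under eq_fun do rewrite mxE.
by rewrite partialZ.
Qed.

(** The factor [c] is the relative weight of the two subsystem metrics. *)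
Definition block_metric {R : realType} {n1 n2 : nat} (c : R)
    (Theta1 : 'cV[R]_n1 -> 'M[R]_n1) (Theta2 : 'cV[R]_n2 -> 'M[R]_n2)
    (x : 'cV[R]_(n1 + n2)) : 'M[R]_(n1 + n2) :=
  block_mx (Theta1 (usubmx x)) 0 0 (c *: Theta2 (dsubmx x)).

Section block_metric_theory.
Context (R : realType) (n1 n2 : nat) (c : R) (c0 : c != 0).
Context (Theta1 : 'cV[R]_n1 -> 'M[R]_n1) (Theta2 : 'cV[R]_n2 -> 'M[R]_n2).

Lemma usubmx_rowsub :
  (usubmx : 'cV[R]_(n1 + n2) -> _) = rowsub (@lshift n1 n2).
Proof. by apply/funext => x; apply/matrixP => a b; rewrite !mxE. Qed.

Lemma dsubmx_rowsub :
  (dsubmx : 'cV[R]_(n1 + n2) -> _) = rowsub (@rshift n1 n2).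
Proof. by apply/funext => x; apply/matrixP => a b; rewrite !mxE. Qed.

Lemma diff_change_coord_block (X : set 'cV[R]_(n1 + n2)) :
  diff_change_coord (usubmx @` X) Theta1 ->
  diff_change_coord (dsubmx @` X) Theta2 ->
  diff_change_coord X (block_metric c Theta1 Theta2).
Proof.
move=> [sm1 u1] [sm2 u2]; split; last first.
  move=> x Xx; rewrite block_diag_mx_unit unitmxZ ?unitfE //.
  by rewrite u1 ?u2 //; exact: imageP.
apply: smooth_on_block_diag; last apply: smooth_onZ.
  rewrite usubmx_rowsub in sm1 *.
  by apply: smooth_on_rowsub sm1; exact: lshift_inj.
rewrite dsubmx_rowsub in sm2 *.
by apply: smooth_on_rowsub sm2; exact: rshift_inj.
Qed.

Lemma dot_block_metric (v x : 'cV[R]_(n1 + n2)) :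
  dot (block_metric c Theta1 Theta2) v x =
  block_mx (dot Theta1 (usubmx v) (usubmx x)) 0
           0 (c *: dot Theta2 (dsubmx v) (dsubmx x)).
Proof.
have sum_block (I : finType) (A : I -> 'M[R]_n1) (B : I -> 'M[R]_n2) :
    \sum_i block_mx (A i) 0 0 (B i) = block_mx (\sum_i A i) 0 0 (\sum_i B i).
  apply: (big_ind3 (fun M A B => M = block_mx A 0 0 B)) => //.
    by rewrite -[RHS]/(block_mx 0 0 0 0) block_mx0.
  by move=> _ ? ? _ ? ? -> ->; rewrite add_block_mx !addr0.
rewrite /dot; under eq_bigr => j _.
  rewrite partial_mx_block_diag (@partial_mxZ _ _ _ _ j c (Theta2 \o dsubmx)).
  rewrite scale_block_mx !scaler0 scalerA mulrC -scalerA.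
  over.
rewrite sum_block -scaler_sumr usubmx_rowsub dsubmx_rowsub.
congr (block_mx _ 0 0 (c *: _)).
  exact: (sum_partial_mx_rowsub (@lshift_inj n1 n2)).
exact: (sum_partial_mx_rowsub (@rshift_inj n1 n2)).
Qed.

(** * The interconnection *)

Context (f1 : 'cV[R]_n1 -> 'cV[R]_n2 -> 'cV[R]_n1).
Context (f2 : 'cV[R]_n1 -> 'cV[R]_n2 -> 'cV[R]_n2).

Lemma jac_of_pair p (g : 'cV[R]_n1 -> 'cV[R]_n2 -> 'cV[R]_p) x1 x2 :
  jac (of_pair g) (col_mx x1 x2) =
  row_mx (jac (fun y1 => g y1 x2) x1) (jac (fun y2 => g x1 y2) x2).
Proof.
apply/matrixP => i j; case: (split_ordP j) => l ->.
  rewrite row_mxEl !mxE; apply: partial_eq_line => t.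
  rewrite /of_pair -(vsubmxK (delta_mx _ _)) scale_col_mx add_col_mx.
  rewrite col_mxKu col_mxKd usubmx_rowsub dsubmx_rowsub.
  rewrite rowsub_delta_codom; last exact: lshift_inj.
  rewrite rowsub_delta_notin ?scaler0 ?add0r //.
  by apply/codomP => -[a /eqP]; rewrite eq_lrshift.
rewrite row_mxEr !mxE; apply: partial_eq_line => t.
rewrite /of_pair -(vsubmxK (delta_mx _ _)) scale_col_mx add_col_mx.
rewrite col_mxKu col_mxKd usubmx_rowsub dsubmx_rowsub.
rewrite (@rowsub_delta_codom _ _ _ (@rshift n1 n2)); last exact: rshift_inj.
rewrite rowsub_delta_notin ?scaler0 ?add0r //.
by apply/codomP => -[a /eqP]; rewrite eq_rlshift.
Qed.

Lemma jac_interconnection x1 x2 :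
  jac (interconnection f1 f2) (col_mx x1 x2) =
  block_mx (jac (fun y1 => f1 y1 x2) x1) (jac (fun y2 => f1 x1 y2) x2)
           (jac (fun y1 => f2 y1 x2) x1) (jac (fun y2 => f2 x1 y2) x2).
Proof.
rewrite block_mxEv -!jac_of_pair; apply/matrixP => i j; rewrite mxE.
case: (split_ordP i) => l ->; rewrite ?col_mxEu ?col_mxEd mxE;
  by congr (partial _ _ _); apply/funext => y; rewrite ?col_mxEu ?col_mxEd.
Qed.

(** Conjugation by a block diagonal matrix acts on each block separately, and
    [c] enters once through the metric and once, inverted, through its
    inverse: the two cancel exactly in the diagonal blocks. *)
Lemma gen_jacobian_block_diag x1 x2 :
    Theta1 x1 \in unitmx -> Theta2 x2 \in unitmx ->
  gen_jacobian (block_metric c Theta1 Theta2) (interconnection f1 f2)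
    (col_mx x1 x2) =
  block_mx
    (gen_jacobian Theta1 (fun y1 => f1 y1 x2) x1)
    (c^-1 *: (Theta1 x1 *m jac (fun y2 => f1 x1 y2) x2 *m invmx (Theta2 x2)))
    (c *: (Theta2 x2 *m jac (fun y1 => f2 y1 x2) x1 *m invmx (Theta1 x1)))
    (gen_jacobian Theta2 (fun y2 => f2 x1 y2) x2).
Proof.
move=> u1 u2; have cu : c *: Theta2 x2 \in unitmx by rewrite unitmxZ ?unitfE.
rewrite /gen_jacobian dot_block_metric jac_interconnection.
rewrite /block_metric /interconnection /of_pair !(col_mxKu, col_mxKd).
rewrite invmx_block_diag ?block_diag_mx_unit ?u1 // invmxZ //.
rewrite !mulmx_block !(mul0mx, mulmx0, addr0, add0r) add_block_mx.
rewrite !(addr0, add0r) -!(scalemxAl, scalemxAr) !scalerA.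
by rewrite mulfV ?mulVf // !scale1r.
Qed.

End block_metric_theory.

(** The power-preserving shape of the coupling: the off-diagonal blocks of
    [F + F^T] are [C^T - C^T] and its transpose. *)
Lemma qform_skew_coupling (R : realType) (n1 n2 : nat) (A : 'M[R]_n1)
    (C : 'M[R]_(n2, n1)) (D : 'M[R]_n2) (d1 : 'cV[R]_n1) (d2 : 'cV[R]_n2) :
  let F := block_mx A (- C^T) C D in
  qform (F + F^T) (col_mx d1 d2) = qform (A + A^T) d1 + qform (D + D^T) d2.
Proof.
rewrite /= /qform tr_block_mx add_block_mx linearN /= trmxK addNr subrr.
rewrite tr_col_mx mul_row_block !(mulmx0, addr0, add0r) mul_row_col.
by rewrite mxE.
Qed.

Theorem theorem6 (R : realType) (n1 n2 : nat)
    (X K : set 'cV[R]_(n1 + n2))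
    (f1 : 'cV[R]_n1 -> 'cV[R]_n2 -> 'cV[R]_n1)
    (f2 : 'cV[R]_n1 -> 'cV[R]_n2 -> 'cV[R]_n2)
    (Theta1 : 'cV[R]_n1 -> 'M[R]_n1) (Theta2 : 'cV[R]_n2 -> 'M[R]_n2)
    (k : R)
    (openX : open X) (KX : K `<=` X)
    (smooth_f1 : smooth_on X (of_pair f1))
    (smooth_f2 : smooth_on X (of_pair f2))
    (coord1 : diff_change_coord (usubmx @` X) Theta1)
    (coord2 : diff_change_coord (dsubmx @` X) Theta2)
    (contracting1 : forall x1 x2, K (col_mx x1 x2) ->
       let F1 := gen_jacobian Theta1 (fun y1 => f1 y1 x2) x1 in
       neg_def (F1 + F1^T))
    (transverse2 : forall x1 x2, K (col_mx x1 x2) ->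
       let F2 := gen_jacobian Theta2 (fun y2 => f2 x1 y2) x2 in
       neg_semidef (F2 + F2^T) /\
       forall d2 : 'cV[R]_n2, d2 != 0 ->
         d2^T *m Theta2 x2 *m f2 x1 x2 = 0 -> qform (F2 + F2^T) d2 < 0)
    (k_gt0 : 0 < k)
    (coupling : forall x1 x2, K (col_mx x1 x2) ->
       let G12 :=
         Theta1 x1 *m jac (fun y2 => f1 x1 y2) x2 *m invmx (Theta2 x2) in
       let G21 :=
         Theta2 x2 *m jac (fun y1 => f2 y1 x2) x1 *m invmx (Theta1 x1) in
       G12 = - k *: G21^T) :
  transverse_contracting X K (interconnection f1 f2).
Proof.
have c0 : Num.sqrt k != 0 by rewrite gt_eqF ?sqrtr_gt0.
exists (block_metric (Num.sqrt k) Theta1 Theta2).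
split; first exact: diff_change_coord_block.
move=> x; rewrite -(vsubmxK x); move: (usubmx x) (dsubmx x) => x1 x2 Kx.
have u1 : Theta1 x1 \in unitmx.
  by apply: coord1.2; exists (col_mx x1 x2); [exact: KX | rewrite col_mxKu].
have u2 : Theta2 x2 \in unitmx.
  by apply: coord2.2; exists (col_mx x1 x2); [exact: KX | rewrite col_mxKd].
rewrite gen_jacobian_block_diag // (coupling _ _ Kx) scalerA.
(* With c ^+ 2 = k, the upper coupling becomes minus the transpose of the
   lower one. *)
have -> : (Num.sqrt k)^-1 * - k = - Num.sqrt k.
  by rewrite mulrN -{2}(sqr_sqrtr (ltW k_gt0)) expr2 mulKf.
rewrite scaleNr -linearZ /= => dz.
rewrite -(vsubmxK dz); move: (usubmx dz) (dsubmx dz) => d1 d2 dn0 orth.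
rewrite qform_skew_coupling.
have [semi2 trans2] := transverse2 _ _ Kx.
have [d10|d1n0] := eqVneq d1 0; last first.
  by rewrite ltr_wnDr ?contracting1 //; exact: semi2.
(* When d1 = 0, the orthogonality hypothesis only involves the second system,
   up to the nonzero factor c. *)
rewrite d10 in dn0 orth *.
have d2n0 : d2 != 0 by apply: contraNneq dn0 => ->; rewrite col_mx0.
rewrite {1}/qform mulmx0 mxE add0r; apply: trans2 => //.
move: orth; rewrite /block_metric /interconnection /of_pair.
rewrite !(col_mxKu, col_mxKd) tr_col_mx mul_row_block mul_row_col.
rewrite trmx0 !(mul0mx, mulmx0, add0r) -scalemxAr -scalemxAl => /eqP.
by rewrite scaler_eq0 (negPf c0) => /eqP.
Qed.
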